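(* The set $conv(S^U)$ is a polyhedron.
   Context: Let $n\ge 1$, $r>0$ a real number and $u=(u_1,\dots,u_n)$ a vector of positive integers. Define $$S^U=\Big\{(x,y)\in\mathbb{Z}^n_+\times\mathbb{R}^n_+ : \sum_{i=1}^n x_iy_i\ge r,\ x\le u\Big\},$$ where $\mathbb{R}_+=[0,\infty)$, $\mathbb{Z}_+=\mathbb{Z}\cap[0,\infty)$ and $x\le u$ is componentwise. $conv$ denotes convex hull in $\mathbb{R}^n\times\mathbb{R}^n$. A polyhedron is an intersection of finitely many closed half-spaces. *)

(* Defs.v *)
From mathcomp Require Import all_boot all_order all_algebra.
From mathcomp Require Import classical_sets cardinality reals convex.

Set Implicit Arguments.
Unset Strict Implicit.
Unset Printing Implicit Defensive.

Import Order.TTheory GRing.Theory Num.Theory.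
Local Open Scope classical_set_scope.
Local Open Scope ring_scope.

Definition convex_hull (R : numDomainType) (M : lmodType R) (A : set M) :
  set M := smallest (@convex_set R M) A.

Notation vpair R n := ('rV[R]_n * 'rV[R]_n)%type.

Definition dot (R : realType) (n : nat) (p q : vpair R n) : R :=
  \sum_i p.1 0 i * q.1 0 i + \sum_i p.2 0 i * q.2 0 i.

(* The normal vector is required to be nonzero; the empty set and the whole
   space are not half-spaces themselves. *)
Definition closed_halfspace (R : realType) (n : nat) (H : set (vpair R n)) :
  Prop :=
  exists2 a : vpair R n, a != 0 &
    exists b : R, H = [set p : vpair R n | b <= dot a p].

Definition polyhedron (R : realType) (n : nat) (P : set (vpair R n)) : Prop :=
  exists F : set (set (vpair R n)),
    [/\ finite_set F, F `<=` @closed_halfspace R n & P = \bigcap_(H in F) H].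

(* [x] ranges over the real vectors with nonnegative integer entries, so that
   the set lives directly in R^n x R^n. *)
Definition SU (R : realType) (n : nat) (r : R) (u : 'rV[nat]_n) :
  set (vpair R n) :=
  [set p : vpair R n |
    [/\ forall i, (p.1 0 i \is a Num.int) && (0 <= p.1 0 i),
        forall i, 0 <= p.2 0 i,
        r <= \sum_i p.1 0 i * p.2 0 i
      & forall i, p.1 0 i <= (u 0 i)%:R]].

(* Main.v *)
Require Import Defs.
From mathcomp Require Import all_boot all_order all_algebra.
From mathcomp Require Import classical_sets cardinality reals convex.
From mathcomp Require Import interval_inference ring lra.
Import Order.TTheory GRing.Theory Num.Theory.
Local Open Scope classical_set_scope.
Local Open Scope ring_scope.

(** For a fixed integer vector x of the box with x != 0, the slice of S^U above
    x is the polyhedron of all y >= 0 with x . y >= r. Its vertices are the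
    points (r / x_i) e_i with x_i > 0, and its recession cone is the nonnegative
    orthant. The slice above x = 0 is empty because r > 0. There are finitely
    many slices and they all have the same recession cone, so conv(S^U) is the
    convex hull of a finite set of vertices (x, (r / x_i) e_i) plus the cone
    spanned by the rays (0, e_i); lemmas [vertices_SU], [SU_rays] and [SU_cone]
    contain this decomposition.

    A set of this shape is a polyhedron by the theorem of Minkowski and Weyl.
    Lifting vertices to height 1 and rays to height 0 turns the hull into the
    section at height 1 of a finitely generated cone ([convex_hull_cone]). Such
    a cone is the solution set of finitely many homogeneous linear inequalities
    ([weyl]): generators are added one at a time, and adding a generator g
    amounts to eliminating its coefficient t from a system of inequalities in
    p - t g, which is Fourier-Motzkin elimination ([fourier_motzkinP]). On the
    section at height 1 the inequalities become affine
    ([polyhedron_cone_section]). *)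

(** * Finitely generated cones and Fourier-Motzkin elimination *)

Section Weyl.
Context {F : realFieldType} {vT : vectType F}.
Local Notation dual := 'Hom(vT, F^o).
Implicit Types (G : seq vT) (A : seq 'Hom(vT, F^o)) (p q g : vT).

(** The inductive form makes minimality of the cone among the sets that contain
    0 and are stable under adding nonnegative multiples of generators its
    induction principle. *)
Inductive cone G : vT -> Prop :=
| cone0 : cone G 0
| cone_step t g p : 0 <= t -> g \in G -> cone G p -> cone G (t *: g + p).

Lemma coneD G p q : cone G p -> cone G q -> cone G (p + q).
Proof.
move=> Gp Gq; elim: Gp => [|t g p' t0 gG _ IH]; first by rewrite add0r.
by rewrite -addrA; exact: cone_step.
Qed.

Lemma cone_gen G t g : 0 <= t -> g \in G -> cone G (t *: g).
Proof.
by move=> t0 gG; rewrite -[_ *: _]addr0; apply: cone_step => //; exact: cone0.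
Qed.

Lemma cone_sum (I : finType) G (f : I -> vT) :
  (forall i, cone G (f i)) -> cone G (\sum_i f i).
Proof.
by move=> Gf; apply: big_ind => //; [exact: cone0|exact: coneD].
Qed.

Lemma cone_consP g G p :
  cone (g :: G) p <-> exists2 t, 0 <= t & cone G (p - t *: g).
Proof.
split=> [|[t t0 Gp]]; last first.
  rewrite -(subrKC (t *: g) p); apply: cone_step => //.
    exact: mem_head.
  elim: Gp => [|s h q s0 hG _ IH]; first exact: cone0.
  by apply: cone_step => //; rewrite inE hG orbT.
elim=> [|s h q s0 + _ [t t0 Gq]].
  by exists 0 => //; rewrite scale0r subr0; exact: cone0.
rewrite inE => /orP[/eqP ->|hG].
  exists (s + t); first exact: addr_ge0.
  by rewrite scalerDl opprD addrACA subrr add0r.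
by exists t => //; rewrite -addrA; exact: cone_step.
Qed.

(** Values are taken in [F] and not in its regular module [F^o], so that the
    order of [F] and its decision procedures apply to them. *)
Definition eval (a : dual) p : F := a p.

Lemma evalB a p q : eval a (p - q) = eval a p - eval a q.
Proof. by rewrite /eval linearB. Qed.

Lemma evalD a p q : eval a (p + q) = eval a p + eval a q.
Proof. by rewrite /eval linearD. Qed.

Lemma evalZ a t p : eval a (t *: p) = t * eval a p.
Proof. by rewrite /eval linearZ. Qed.

Lemma eval_comb (s t : F) a b p :
  eval (s *: a - t *: b) p = s * eval a p - t * eval b p.
Proof. by rewrite /eval add_lfunE opp_lfunE !scale_lfunE. Qed.

Definition solution A p := forall a, a \in A -> 0 <= eval a p.

(** In a p - t (a g) >= 0, the forms with a g > 0 bound t from above and those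
    with b g < 0 bound it from below. Eliminating t keeps the comparison of
    each lower bound with each upper bound, cleared of denominators. Comparing
    an upper bound with the further lower bound 0 gives back a p >= 0, and this
    is also what remains of a form with a g = 0. *)
Definition fourier_motzkin g A : seq dual :=
  [seq a <- A | 0 <= eval a g] ++
  [seq eval a g *: b - eval b g *: a | a <- [seq a <- A | 0 < eval a g],
                                       b <- [seq b <- A | eval b g < 0]].

Lemma seq_separation (L U : seq F) :
  (forall l u, l \in L -> u \in U -> l <= u) ->
  exists t, (forall l, l \in L -> l <= t) /\ (forall u, u \in U -> t <= u).
Proof.
elim: L => [|l L IH] LU.
  elim: U {LU} => [|u U [t [_ tU]]]; first by exists 0.
  exists (Num.min u t); split=> // v; rewrite inE ge_min => /orP[/eqP ->|vU].
    by rewrite lexx.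
  by rewrite (tU _ vU) orbT.
case: IH => [k u kL uU|t [Lt tU]]; first by apply: LU; rewrite // inE kL orbT.
exists (Num.max l t); split=> [k|u uU].
  rewrite inE le_max => /orP[/eqP ->|kL]; first by rewrite lexx.
  by rewrite (Lt _ kL) orbT.
by rewrite ge_max tU // LU // mem_head.
Qed.

Lemma fourier_motzkinP g A p :
  solution (fourier_motzkin g A) p <->
  exists2 t, 0 <= t & solution A (p - t *: g).
Proof.
split=> [sol|[t t0 sol] c]; last first.
  rewrite mem_cat => /orP[|/allpairsP[[a b] /= []]].
    rewrite mem_filter => /andP[cg0 /sol]; rewrite evalB evalZ subr_ge0.
    by apply: le_trans; exact: mulr_ge0.
  rewrite !mem_filter => /andP[ag0 /sol +] /andP[bg0 /sol +] ->.
  by rewrite eval_comb !evalB !evalZ; nra.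
(* The head 0 of the lower bounds is the constraint 0 <= t. *)
have [t [tlow tup]] : exists t : F,
    (forall l, l \in 0 :: [seq eval b p / eval b g | b <- A & eval b g < 0] ->
      l <= t) /\
    (forall v, v \in [seq eval a p / eval a g | a <- A & 0 < eval a g] ->
      t <= v).
  apply: seq_separation => l v + /mapP[a].
  rewrite mem_filter => + /andP[ag aA] ->.
  rewrite inE => /orP[/eqP ->|/mapP[b]].
    rewrite divr_ge0 // ?(ltW ag) //; apply: sol.
    by rewrite mem_cat mem_filter (ltW ag) aA.
  rewrite mem_filter => /andP[bg bA] ->.
  have /sol : eval a g *: b - eval b g *: a \in fourier_motzkin g A.
    rewrite mem_cat; apply/orP; right; apply/allpairsP; exists (a, b) => /=.
    by rewrite !mem_filter ag bg aA bA.
  rewrite eval_comb subr_ge0 => H.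
  by rewrite ler_pdivlMr // mulrAC ler_ndivrMr // ![eval _ p * _]mulrC.
exists t; first by apply: tlow; exact: mem_head.
move=> a aA; rewrite evalB evalZ subr_ge0.
have [ag|ag|ag] := ltgtP (eval a g) 0.
- rewrite -ler_ndivrMr //; apply: tlow; rewrite inE; apply/orP; right.
  by apply/mapP; exists a => //; rewrite mem_filter ag.
- rewrite -ler_pdivlMr //; apply: tup.
  by apply/mapP; exists a => //; rewrite mem_filter ag.
- by rewrite ag mulr0; apply: sol; rewrite mem_cat mem_filter ag lexx aA.
Qed.

(** Weyl's theorem. The cone without generators is {0}, cut out by the
    coordinate forms and their opposites; each further generator is one
    elimination step. *)
Theorem weyl G : exists A, forall p, cone G p <-> solution A p.
Proof.
elim: G => [|g G [A AP]]; last first.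
  exists (fourier_motzkin g A) => p; rewrite cone_consP fourier_motzkinP.
  by split=> -[t t0 /AP]; exists t.
pose c i : dual := linfun (coord (vbasis {:vT}) i : vT -> F^o).
pose I := enum 'I_(\dim {:vT}).
exists ([seq c i | i <- I] ++ [seq - c i | i <- I]) => p; split=> [Gp a _|sol].
  suff -> : p = 0 by rewrite /eval linear0.
  by case: Gp => // t g q _; rewrite in_nil.
suff -> : p = 0 by exact: cone0.
rewrite (coord_vbasis (memvf p)) big1 // => i _.
suff -> : coord (vbasis {:vT}) i p = 0 by rewrite scale0r.
have Ii : i \in I by rewrite mem_enum.
have ge0 : 0 <= eval (c i) p by apply: sol; rewrite mem_cat map_f.
have le0 : 0 <= eval (- c i) p.
  by apply: sol; rewrite mem_cat; apply/orP; right; exact: map_f.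
apply/eqP; rewrite eq_le -oppr_ge0.
by move: ge0 le0; rewrite /eval opp_lfunE lfunE => -> ->.
Qed.

End Weyl.

(** * Convex hulls as sections of cones *)

Section Hull.
Context {R : realType} {n : nat}.
Local Notation V := (vpair R n).
Local Notation lift := (V * R^o)%type.
Implicit Types (S D : set V) (p q v c : V).

Lemma convex_setP D : @convex_set R V D <->
  forall p q (t : R), 0 <= t -> t <= 1 -> D p -> D q ->
    D (t *: p + (1 - t) *: q).
Proof.
split=> [cD p q t t0 t1 /mem_set Dp /mem_set Dq | cD p q t].
  have t01 : Itv.spec (Itv.num_sem (R:=R)) (Itv.Real `[0%Z, 1%Z]) t.
    by rewrite /= /Itv.num_sem /= in_itv /= t0 t1 num_real.
  by have /set_mem := cD _ _ (Itv.mk t01) Dp Dq.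
move=> /set_mem Dp /set_mem Dq; apply/mem_set.
exact: (cD p q t%:num).
Qed.

Lemma convex_hull_convex S : @convex_set R V (convex_hull S).
Proof.
apply/convex_setP => p q t t0 t1 Sp Sq D DS; have [cD _] := DS.
exact: (proj1 (convex_setP D) cD p q t t0 t1 (Sp D DS) (Sq D DS)).
Qed.

Lemma convex_hull_translate S c :
  (forall p, S p -> S (p + c)) ->
  forall p, convex_hull S p -> convex_hull S (p + c).
Proof.
move=> Sc p Sp; apply: (Sp [set q | convex_hull S (q + c)]).
split=> [|q Sq]; last by apply: sub_gen_smallest; exact: Sc.
apply/convex_setP => p1 p2 t t0 t1 /= S1 S2.
have -> : t *: p1 + (1 - t) *: p2 + c = t *: (p1 + c) + (1 - t) *: (p2 + c).
  by rewrite !scalerDr addrACA -scalerDl subrKC scale1r.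
exact: (proj1 (convex_setP _) (convex_hull_convex S)).
Qed.

(** Points are lifted to height 1 and directions to height 0, so that the
    section at height 1 of the cone consists of the convex combinations of [vs]
    plus the nonnegative combinations of [cs]. *)
Definition homogenize (vs cs : seq V) : seq lift :=
  [seq (v, 1 : R^o) | v <- vs] ++ [seq (c, 0 : R^o) | c <- cs].

(** The inclusion cannot be proved at height 1 alone, since partial sums of
    generators have other heights. The invariant [K] says that an element at
    height s > 0 is s times a point of [D], and that an element at height 0 is a
    direction in which [D] recedes. *)
Lemma cone_sub_convex (vs cs : seq V) D :
  @convex_set R V D -> (forall v, v \in vs -> D v) ->
  (forall c (t : R) p, c \in cs -> 0 <= t -> D p -> D (p + t *: c)) ->
  forall p, cone (homogenize vs cs) (p, 1 : R^o) -> D p.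
Proof.
move=> /convex_setP cD Dv Dc.
pose K (q : lift) := [/\ 0 <= (q.2 : R),
   (q.2 : R) = 0 -> forall h (k : R), D h -> 0 <= k -> D (h + k *: q.1) &
   0 < (q.2 : R) -> D ((q.2 : R)^-1 *: q.1)].
suff sub (q : lift) : cone (homogenize vs cs) q -> K q.
  by move=> p /sub[_ _ /(_ ltr01)]; rewrite /= invr1 scale1r.
elim=> [|t g [x s] t0 + _].
  split=> /= [|_ h k Dh _|]; rewrite ?scaler0 ?addr0 ?ltxx //.
have [->|tN0] := eqVneq t 0; first by rewrite scale0r add0r.
have {tN0} tp : 0 < t by rewrite lt_neqAle eq_sym tN0.
(* Scaling in the regular module is multiplication. *)
rewrite mem_cat => /orP[] /mapP[v vV ->] [/= s0 rec pos]; rewrite /K /=;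
  rewrite -?[t *: (1 : R^o)]/(t * 1 : R) -?[t *: (0 : R^o)]/(t * 0 : R).
- rewrite mulr1; split=> [|e0|_]; first exact: addr_ge0.
    by move: tp s0; lra.
  have [e0|sN0] := eqVneq (s : R) 0.
    have -> : (t + s)^-1 *: (t *: v + x) = v + t^-1 *: x.
      by rewrite e0 addr0 scalerDr scalerA mulVf ?gt_eqF // scale1r.
    by apply: rec; rewrite ?invr_ge0 //; exact: Dv.
  have sp : 0 < (s : R) by rewrite lt_neqAle eq_sym sN0.
  have tsp : 0 < t + s by exact: addr_gt0.
  (* The new vertex is mixed into the old point in proportion t : s. *)
  have -> : (t + s)^-1 *: (t *: v + x) =
     (t / (t + s)) *: v + (1 - t / (t + s)) *: ((s : R)^-1 *: x).
    rewrite scalerDr !scalerA mulrC; congr (_ + _ *: _).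
    by field; rewrite !gt_eqF.
  apply: cD; [exact: divr_ge0 (ltW tp) (ltW tsp) | | exact: Dv | exact: pos].
  by rewrite ler_pdivrMr // mul1r lerDl.
- rewrite mulr0 add0r; split=> // [e0 h k Dh k0|sp].
    rewrite scalerDr addrA scalerA; apply: rec => //.
    by apply: Dc => //; exact: mulr_ge0.
  rewrite scalerDr scalerA addrC; apply: Dc => //; last exact: pos.
  by rewrite mulr_ge0 // invr_ge0 ltW.
Qed.

(** The section of the cone is convex, being cut out by inequalities, so it
    contains the hull of [S] as soon as it contains [S]; the converse inclusion
    is [cone_sub_convex] applied to the hull, which recedes along [cs] because
    [S] does. *)
Lemma convex_hull_cone S (vs cs : seq V) :
  (forall v, v \in vs -> S v) ->
  (forall c (t : R) p, c \in cs -> 0 <= t -> S p -> S (p + t *: c)) ->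
  (forall p, S p -> cone (homogenize vs cs) (p, 1 : R^o)) ->
  forall p, convex_hull S p <-> cone (homogenize vs cs) (p, 1 : R^o).
Proof.
move=> Sv Sc Scone p; split=> [|Cp]; last first.
  apply: (cone_sub_convex vs cs) Cp.
  - exact: convex_hull_convex.
  - by move=> v /Sv Sv'; exact: sub_gen_smallest.
  - move=> c t q cc t0; apply: convex_hull_translate => q'; exact: Sc.
apply: (@smallest_sub _ _ _ [set q | cone _ (q, 1 : R^o)]) => //.
apply/convex_setP => p1 p2 t t0 t1 /=.
have [A AP] := weyl (homogenize vs cs).
move=> /AP C1 /AP C2; apply/AP => a aA.
have -> : (t *: p1 + (1 - t) *: p2, 1 : R^o) =
          t *: (p1, 1 : R^o) + (1 - t) *: (p2, 1 : R^o) :> lift.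
  congr pair => /=; rewrite -?[t *: (1 : R^o)]/(t * 1 : R).
  by rewrite -[(1 - t) *: (1 : R^o)]/((1 - t) * 1 : R) !mulr1 subrKC.
rewrite evalD !evalZ; apply: addr_ge0; apply: mulr_ge0 => //.
- exact: C1.
- by rewrite subr_ge0.
- exact: C2.
Qed.

Definition normal (a : 'Hom(lift, R^o)) : V :=
  (\row_i a ((delta_mx 0 i, 0), 0), \row_i a ((0, delta_mx 0 i), 0)).

Lemma lfun_dot a p (s : R) :
  eval a (p, s : R^o) = dot (normal a) p + s * eval a (0, 1 : R^o).
Proof.
rewrite /eval.
have -> : (p, s : R^o) =
    ((p.1, 0), 0) + ((0, p.2), 0) + s *: (0, 1 : R^o) :> lift.
  case: p => x y; congr ((_, _), _) => /=; rewrite ?scaler0 ?addr0 ?add0r //.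
  by rewrite -[s *: (1 : R^o)]/(s * 1 : R) mulr1.
rewrite !linearD linearZ; congr (_ + _ + _).
  rewrite {1}[p.1]row_sum_delta.
  rewrite (big_morph (fun x => ((x, 0), 0) : lift) (id1 := 0) (op1 := +%R)) //.
    rewrite linear_sum; apply: eq_bigr => i _; rewrite mxE mulrC.
    rewrite -[RHS]/(p.1 0 i *: (_ : R^o)) -linearZ; congr (a _).
    by congr ((_, _), _) => /=; rewrite !scaler0.
  by move=> x y; congr ((_, _), _) => /=; rewrite addr0.
rewrite {1}[p.2]row_sum_delta.
rewrite (big_morph (fun x => ((0, x), 0) : lift) (id1 := 0) (op1 := +%R)) //.
  rewrite linear_sum; apply: eq_bigr => i _; rewrite mxE mulrC.
  rewrite -[RHS]/(p.2 0 i *: (_ : R^o)) -linearZ; congr (a _).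
  by congr ((_, _), _) => /=; rewrite !scaler0.
by move=> x y; congr ((_, _), _) => /=; rewrite addr0.
Qed.

(** Weyl's inequalities restrict to affine ones at height 1. Those whose linear
    part vanishes do not define half-spaces; they are constants, and hold
    everywhere since they hold at some point of [P]. *)
Lemma polyhedron_cone_section (G : seq lift) (P : set V) :
  (forall p, P p <-> cone G (p, 1 : R^o)) -> P !=set0 -> polyhedron P.
Proof.
have [A AP] := weyl G; move=> PG [v Pv].
pose H a := [set p : V | - eval a (0, 1 : R^o) <= dot (normal a) p].
have HE a p : H a p <-> 0 <= eval a (p, 1 : R^o).
  by rewrite lfun_dot mul1r -lerBlDr sub0r.
have PA p : P p <-> forall a, a \in A -> H a p.
  rewrite PG AP; split=> sol a aA; first by apply/HE/sol.
  exact/HE/sol.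
exists [set H a | a in [set` [seq a <- A | normal a != 0]]]; split.
- exact/finite_image/finite_seq.
- move=> _ [a /= aA <-]; move: aA; rewrite mem_filter => /andP[aN0 _].
  by exists (normal a) => //; exists (- eval a (0, 1 : R^o)).
apply/seteqP; split=> [p /PA Pp _ [a /= aA <-]|p Hp].
  by move: aA; rewrite mem_filter => /andP[_ /Pp].
apply/PA => a aA; have [a0|aN0] := eqVneq (normal a) 0.
  have := proj1 (PA v) Pv a aA; rewrite /H /= a0 /dot /=.
  by rewrite !big1 // => i _; rewrite !mxE mul0r.
by apply: (Hp (H a)); exists a => //=; rewrite mem_filter aN0.
Qed.

End Hull.

(** * Vertices and rays of the bilinear covering set *)

Section Box.
Context {R : realType} {n : nat} (r : R) (u : 'rV[nat]_n) (hr : 0 < r).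
Local Notation V := (vpair R n).
Local Notation box := {dffun forall i : 'I_n, 'I_(u 0 i).+1}.

Definition coords (x : box) : 'rV[R]_n := \row_i (x i : nat)%:R.
Definition vertex (x : box) (i : 'I_n) : V :=
  (coords x, (r / (x i : nat)%:R) *: delta_mx 0 i).
(** The filter [x i != 0] matters: for x i = 0 the quotient r / 0 is 0 by
    convention and the point (x, 0) lies outside the set. *)
Definition vertices : seq V :=
  [seq vertex xi.1 xi.2 | xi : box * 'I_n <- enum {: box * 'I_n}
                        & (xi.1 xi.2 : nat) != 0%N].
Definition rays : seq V := [seq (0, delta_mx 0 i) | i <- enum 'I_n].

Lemma coords_surj (x : 'rV[R]_n) :
  (forall i, (x 0 i \is a Num.int) && (0 <= x 0 i)) ->
  (forall i, x 0 i <= (u 0 i)%:R) -> exists z : box, x = coords z.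
Proof.
move=> xint xu.
exists [ffun i => inord (Num.truncn (x 0 i)) : 'I_(u 0 i).+1].
apply/rowP => i; rewrite mxE ffunE.
have xE : x 0 i = (Num.truncn (x 0 i))%:R.
  by rewrite truncnK // natrEint xint.
by rewrite inordK // ltnS -(ler_nat R) -xE.
Qed.

Lemma vertices_SU v : v \in vertices -> SU r u v.
Proof.
move=> /mapP[[x i]]; rewrite mem_filter => /andP[/= xi0 _] ->.
have xr0 : (x i : nat)%:R != 0 :> R by rewrite pnatr_eq0.
split=> /= [j|j||j]; rewrite ?mxE.
- by rewrite natr_int ler0n.
- by rewrite !mulr_ge0 ?invr_ge0 ?ler0n // ltW.
- rewrite (bigD1 i) //= big1 ?addr0 => [|j /negbTE ji].
    by rewrite !mxE !eqxx mulr1 mulrC divfK.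
  by rewrite !mxE ji /= !mulr0.
- by rewrite ler_nat -ltnS.
Qed.

Lemma SU_rays c (t : R) p :
  c \in rays -> 0 <= t -> SU r u p -> SU r u (p + t *: c).
Proof.
move=> /mapP[i _ ->] t0 [xint y0 xy xu].
have le j : p.2 0 j <= (p + t *: (0, delta_mx 0 i)).2 0 j.
  by rewrite !mxE lerDl mulr_ge0.
have E j : (p + t *: (0, delta_mx 0 i)).1 0 j = p.1 0 j.
  by rewrite /= scaler0 addr0.
split=> [j|j||j]; rewrite ?E //; first exact: le_trans (le j).
apply: le_trans xy _; apply: ler_sum => j _; rewrite E ler_wpM2l //.
by have /andP[] := xint j.
Qed.

(** With s = x . y >= r, weigh the vertex on the i-th axis by x_i y_i / s. These
    weights sum to 1, and the combination of the vertices is (r / s) y on the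
    support of x and 0 elsewhere. It is at most y in each coordinate, so that
    nonnegative multiples of the rays make up the difference. *)
Lemma SU_cone p :
  SU r u p -> cone (homogenize vertices rays) (p, 1 : R^o).
Proof.
case: p => x y [/= xint y0 xy xu].
have [z xE] := coords_surj x xint xu.
set s := \sum_i _ in xy; have s0 : 0 < s by exact: lt_le_trans xy.
have zx i : (z i : nat)%:R = x 0 i by rewrite xE mxE.
pose lam i := x 0 i * y 0 i / s.
pose mu i := y 0 i - lam i * (r / x 0 i).
have lam0 i : 0 <= lam i.
  by rewrite !mulr_ge0 ?invr_ge0 ?(ltW s0) // -zx ler0n.
have mu0 i : 0 <= mu i.
  rewrite subr_ge0 /lam; have [->|xN0] := eqVneq (x 0 i) 0.
    by rewrite !mul0r.
  have -> : x 0 i * y 0 i / s * (r / x 0 i) = (r / s) * y 0 i.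
    by field; rewrite xN0 gt_eqF.
  by rewrite ler_piMl // ler_pdivrMr // mul1r.
have slam : \sum_i lam i = 1 by rewrite -mulr_suml divff // gt_eqF.
have -> : ((x, y), 1 : R^o) =
    \sum_i (lam i *: (vertex z i, 1 : R^o) +
            mu i *: ((0, delta_mx 0 i), 0 : R^o))
    :> V * R^o.
  rewrite [RHS]surjective_pairing !raddf_sum /=; congr (_, _).
    rewrite [RHS]surjective_pairing !raddf_sum /=; congr (_, _).
  - rewrite -[LHS]scale1r -slam scaler_suml; apply: eq_bigr => i _.
    by rewrite scaler0 addr0 -xE.
  - rewrite [LHS]row_sum_delta; apply: eq_bigr => i _.
    by rewrite scalerA -scalerDl zx subrKC.
  - rewrite -[LHS]slam; apply: eq_bigr => i _ /=.
    by rewrite -[RHS]/(lam i * 1 + mu i * 0) mulr1 mulr0 addr0.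
apply: cone_sum => i; apply: coneD; last first.
  apply: cone_gen => //; rewrite mem_cat; apply/orP; right.
  by apply/map_f/map_f; rewrite mem_enum.
have [zi0|ziN0] := eqVneq (z i : nat) 0%N.
  by rewrite /lam -zx zi0 !mul0r scale0r; exact: cone0.
apply: cone_gen => //; rewrite mem_cat; apply/orP; left; apply: map_f.
by apply/mapP; exists (z, i); rewrite // mem_filter /= ziN0 mem_enum.
Qed.

End Box.

Theorem proposition1 (R : realType) (n : nat) (r : R) (u : 'rV[nat]_n)
    (hn : (1 <= n)%N) (hr : 0 < r) (hu : forall i : 'I_n, (0 < u 0%R i)%N) :
  polyhedron (convex_hull (SU r u)).
Proof.
have hull := @convex_hull_cone _ _ (SU r u) (vertices r u) (rays (R := R))
  (@vertices_SU _ _ r u hr) (@SU_rays _ _ r u) (@SU_cone _ _ r u hr).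
apply: (polyhedron_cone_section _ _ hull).
pose i0 := Ordinal hn.
(* All x_i = 1 is allowed since u > 0, and one coordinate y_i = r suffices. *)
exists (const_mx 1, const_mx r); apply: sub_gen_smallest.
split=> /= [i|i||i]; rewrite ?mxE.
- by rewrite rpred1 ler01.
- exact: ltW.
- under eq_bigr do rewrite !mxE mul1r.
  by rewrite (bigD1 i0) //= lerDl; apply: sumr_ge0 => i _; exact: ltW.
- by rewrite ler1n.
Qed.
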